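(* Let $k$ be a positive integer and let $G$ be a graph that contains none of $K_{1,k}$, $kK_2$ (a matching with $k$ edges) and $2K_{1,k-1}$ (two vertex-disjoint copies of $K_{1,k-1}$) as a subgraph. Then $$e(G)\le g_1(k)=\begin{cases}k^2-\frac32k+\frac12 & k \text{ odd},\\ k^2-\frac32 k & k \text{ even}.\end{cases}$$ Furthermore, up to adding or deleting isolated vertices, equality holds if and only if $G=R(2k-1,k-1)$ when $k$ is odd, and $G=R(2k-1,k-1)$ or $G=R(k+1,k-1)\cup K_{k-1}$ when $k$ is even.
   Context: $e(G)$ is the number of edges of $G$. $R(n,d)$ denotes an almost $d$-regular graph on $n$ vertices, i.e. a graph on $n$ vertices in which all vertices have degree $d$ except at most one vertex of degree $d-1$. $G_1\cup G_2$ denotes disjoint union. *)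

(* Defs.v *)
From mathcomp Require Import all_boot.
Unset Printing Implicit Defensive.

Definition simple_graph {T : finType} (e : rel T) : Prop :=
  symmetric e /\ irreflexive e.

Definition nedges {T : finType} (e : rel T) : nat :=
  #|[set [set x; y] | x in T, y in T & e x y]|.

Definition deg {T : finType} (e : rel T) (x : T) : nat := #|[set y | e x y]|.

Definition contains {V T : finType} (h : rel V) (e : rel T) : Prop :=
  exists f : V -> T, injective f /\ forall x y, h x y -> e (f x) (f y).

Definition star_graph (k : nat) : rel 'I_k.+1 :=
  fun x y => (x == ord0) != (y == ord0).

Definition matching_graph (k : nat) : rel ('I_k * bool)%type :=
  fun x y => (x.1 == y.1) && (x.2 != y.2).

Definition two_stars_graph (k : nat) : rel (bool * 'I_k.-1.+1)%type :=
  fun x y => (x.1 == y.1) && ((x.2 == ord0) != (y.2 == ord0)).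

Definition almost_regular {U : finType} (e : rel U) (d : nat) : Prop :=
  (forall x, deg e x = d \/ deg e x = d.-1) /\ #|[set x | deg e x != d]| <= 1.

Definition non_isolated {T : finType} (e : rel T) : {set T} :=
  [set x | [exists y, e x y]].

Definition iso_upto_isolated {T U : finType} (e : rel T) (h : rel U) : Prop :=
  exists f : T -> U,
    {in non_isolated e &, injective f} /\
    (forall x y, x \in non_isolated e -> y \in non_isolated e ->
       h (f x) (f y) = e x y) /\
    f @: non_isolated e = non_isolated h.

Definition union_with_clique {m : nat} (n : nat) (r : rel 'I_m) : rel ('I_m + 'I_n)%type :=
  fun x y => match x, y with
             | inl a, inl b => r a b
             | inr a, inr b => a != b
             | _, _ => false
             end.

(* g_1(k) = k^2 - 3k/2 + 1/2 (k odd), k^2 - 3k/2 (k even); exact divisions *)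
Definition g1 (k : nat) : nat :=
  if odd k then ((k - 1) * (2 * k - 1)) %/ 2 else (k * (2 * k - 3)) %/ 2.

(* Main.v *)
Require Import Defs.
From mathcomp Require Import all_boot zify.

(** Put [d = k - 1]. By the Berge-Tutte formula there are a set [S] and a
    partition of the other vertices into blocks with no edge between two
    blocks, such that [#|S| + \sum_C #|C|./2 <= d]. The edges meeting [S]
    number at most [d * #|S|], and a block [C] spans at most [d * #|C|./2]
    edges, except that an odd block with more than [d] vertices may span [d./2]
    more. Two such big blocks force [S] to be empty and both blocks to have
    [d + 1] vertices; as two vertices of degree [d] have intersecting closed
    neighbourhoods, one of the blocks then has all its degrees below [d], and
    the bound is strict. Otherwise the bound is [d ^ 2 + d./2], which is
    [g1 k]. In the case of equality there is one big block, all of whose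
    vertices but at most one have degree [d] inside it. A vertex outside it has
    degree less than [d]: its closed neighbourhood could meet those of the
    vertices of the big block only in the exceptional one, whose degree would
    then exceed [d]. Hence [S] is empty, and the other blocks are single
    vertices or one clique on [d] vertices. *)

Set Implicit Arguments.
Unset Strict Implicit.

Lemma bigD2 (R : Type) (idx : R) (op : Monoid.com_law idx) (I : finType)
    (A : {pred I}) (i j : I) (F : I -> R) :
  i \in A -> j \in A -> i != j ->
  \big[op/idx]_(k in A) F k =
    op (F i) (op (F j) (\big[op/idx]_(k in A | (k != i) && (k != j)) F k)).
Proof.
move=> iA jA ij; rewrite (bigD1 i) //= (bigD1 j) ?jA 1?eq_sym //=.
by rewrite (eq_bigl _ _ (fun k => andbA _ _ _)).
Qed.

Lemma exists_setD_neq (T : finType) (A B : {set T}) u v t :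
  #|B| <= #|A| -> u \in B :\: A -> v \in B :\: A -> u != v ->
  exists2 x, x \in A :\: B & x != t.
Proof.
move=> card_BA uBA vBA uv.
have card_BA_ge2 : 2 <= #|B :\: A|.
  have <- : #|[set u; v]| = 2 by rewrite cards2 uv.
  by rewrite subset_leq_card // subUset !sub1set uBA.
have card_diff : #|B :\: A| <= #|A :\: B| by rewrite !cardsD setIC leq_sub2r.
have /card_gt0P[x] : 0 < #|(A :\: B) :\ t|.
  move: (leq_trans card_BA_ge2 card_diff).
  by rewrite (cardsD1 t); case: (t \in _); lia.
by rewrite in_setD1 => /andP[xt xAB]; exists x.
Qed.

Lemma card_partition_setI (T : finType) (P : {set {set T}}) (A W : {set T}) :
  partition P W -> A \subset W -> #|A| = \sum_(C in P) #|A :&: C|.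
Proof.
move=> parP /setIidPr sAW; rewrite -{1}sAW -sum1_card.
rewrite (eq_bigl (fun x => (x \in W) && (x \in A))); last first.
  by move=> x; rewrite inE.
rewrite (set_partition_big_cond _ parP); apply: eq_bigr => C _.
by rewrite -sum1_card; apply: eq_bigl => x; rewrite inE andbC.
Qed.

Section FixpointFreeInvolution.
Variables (T : finType) (f : T -> T) (A : {pred T}).
Hypotheses (fK : involutive f) (fA : {homo f : x / x \in A}).
Hypothesis fN : {in A, forall x, f x != x}.

Lemma card_involution : #|A| = (fcard f A).*2.
Proof.
rewrite -muln2 (fcard_order_set (inv_inj fK)) //; last first.
  by move=> x _ /eqP <-; apply/idP/idP => /fA; rewrite ?fK.
apply/subsetP=> x xA; rewrite inE (@order_cycle _ f [:: x; f x]) ?mem_head //=.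
  by rewrite fK !eqxx.
by rewrite inE eq_sym fN.
Qed.

Lemma even_involution : ~~ odd #|A|.
Proof. by rewrite card_involution odd_double. Qed.

End FixpointFreeInvolution.

(** * Maximum matchings *)

Section Matching.
Variables (T : finType) (e : rel T).
Hypotheses (sym : symmetric e) (irr : irreflexive e).
Implicit Types (W S : {set T}) (P : {set {set T}}) (f g M N : {ffun T -> T}).

Definition covered f := [set x | f x != x].

(* A matching of the subgraph induced by [W] is the involution exchanging the
   ends of its edges, so that its fixed points are the unmatched vertices. *)
Definition matching W f :=
  [forall x, f (f x) == x] && [forall x in covered f, (x \in W) && e x (f x)].

Lemma matchingP W f :
  reflect (involutive f /\ forall x, f x != x -> x \in W /\ e x (f x))
          (matching W f).
Proof.
apply: (iffP andP) => -[fK fW]; split.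
- by move=> x; apply/eqP/(forallP fK).
- by move=> x fx; apply/andP/(forall_inP fW); rewrite inE.
- by apply/forallP=> x; rewrite fK.
- by apply/forall_inP=> x; rewrite inE => /fW[-> ->].
Qed.

Lemma matching_edge W f x :
  matching W f -> f x != x -> [/\ x \in W, f x \in W & e x (f x)].
Proof.
case/matchingP=> fK fe fx; have [xW exfx] := fe x fx.
by have [//|fxW _] := fe (f x); first by rewrite fK eq_sym.
Qed.

Lemma card_covered W f :
  matching W f -> #|covered f| = (fcard f (covered f)).*2.
Proof.
case/matchingP=> fK _; apply: (card_involution fK) => x; rewrite !inE //.
by rewrite fK eq_sym.
Qed.

Definition max_covered W := \max_(f | matching W f) #|covered f|.

Definition maximum_matching W f :=
  matching W f && (#|covered f| == max_covered W).

Lemma leq_max_covered W f : matching W f -> #|covered f| <= max_covered W.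
Proof. exact: leq_bigmax_cond. Qed.

Lemma maximum_matching_geq W f :
  matching W f -> max_covered W <= #|covered f| -> maximum_matching W f.
Proof.
by move=> fW ge_max; rewrite /maximum_matching fW eqn_leq leq_max_covered.
Qed.

Lemma maximum_matching_exists W : {f | maximum_matching W f}.
Proof.
have idW : matching W [ffun x => x].
  by apply/matchingP; split=> x; rewrite !ffunE ?eqxx.
have [|f fW max_f] := @eq_bigmax_cond _ (matching W) (fun f => #|covered f|).
  by apply/card_gt0P; exists [ffun x => x].
by exists f; apply/andP; split; last exact/eqP/esym.
Qed.

Definition rematch f x y : {ffun T -> T} :=
  [ffun w => if w == x then y else if w == y then x
             else if w == f y then w else f w].

Section Rematch.
Variables (W : {set T}) (f : {ffun T -> T}) (x y : T).
Hypotheses (fW : matching W f) (fx : f x = x).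
Hypotheses (xW : x \in W) (yW : y \in W) (exy : e x y).

Let fK : involutive f. Proof. by case/matchingP: fW. Qed.
Let xy : x != y. Proof. by apply: contraTneq exy => ->; rewrite irr. Qed.

Lemma rematch_matching : matching W (rematch f x y).
Proof.
apply/matchingP; split=> w; rewrite !ffunE.
  have [->|wx] := eqVneq w x; first by rewrite eq_sym (negbTE xy) eqxx.
  have [->|wy] := eqVneq w y; first by rewrite eqxx.
  have [<-|wfy] := eqVneq w (f y).
    by rewrite eqxx (negbTE wx) (negbTE wy).
  by rewrite !(can2_eq fK fK) fx fK (negbTE wx) (negbTE wy) (negbTE wfy).
have [->|wx] := eqVneq w x; first by [].
have [->|wy] := eqVneq w y; first by rewrite sym.
have [->|wfy] := eqVneq w (f y); first by rewrite eqxx.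
by case/matchingP: fW => _; apply.
Qed.

Lemma covered_rematch : covered (rematch f x y) = x |: (y |: covered f :\ f y).
Proof.
apply/setP=> w; rewrite !inE !ffunE.
have [->|wx] := eqVneq w x; first by rewrite eq_sym.
have [->|wy] := eqVneq w y; first by [].
by have [->|] := eqVneq w (f y); rewrite ?eqxx.
Qed.

Lemma card_covered_rematch :
  #|covered (rematch f x y)| = #|covered f| + (f y == y).*2.
Proof.
have xC : x \notin covered f by rewrite inE fx eqxx.
rewrite covered_rematch !cardsU1 !inE fx eqxx (negbTE xy) andbF /= add1n.
rewrite (cardsD1 (f y) (covered f)) inE fK eq_sym.
by rewrite andbb; case: (f y == y); lia.
Qed.

End Rematch.

Section MaximumMatching.
Variable W : {set T}.

Lemma maximum_matching_edge f x y :
  maximum_matching W f -> f x = x -> x \in W -> y \in W -> e x y -> f y != y.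
Proof.
move=> /andP[fW /eqP max_f] fx xW yW exy; apply/eqP=> fy.
have := leq_max_covered (rematch_matching fW fx xW yW exy).
by rewrite (card_covered_rematch fW) // max_f fy eqxx; lia.
Qed.

Lemma maximum_rematch f x y :
  maximum_matching W f -> f x = x -> x \in W -> y \in W -> e x y ->
  maximum_matching W (rematch f x y).
Proof.
move=> /andP[fW /eqP max_f] fx xW yW exy.
apply: maximum_matching_geq; first exact: rematch_matching.
by rewrite (card_covered_rematch fW) // max_f leq_addr.
Qed.

Definition gallai_rel u v :=
  (u == v) || [forall f, maximum_matching W f ==> (f u != u) || (f v != v)].

Lemma gallai_relP u v :
  reflect (forall f, maximum_matching W f -> f u = u -> f v = v -> u = v)
          (gallai_rel u v).
Proof.
apply: (iffP orP) => [[/eqP->//|/forallP uv] f max_f fu fv | uv].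
  by have /implyP/(_ max_f) := uv f; rewrite fu fv !eqxx.
have [->|neq] := eqVneq u v; [by left | right].
apply/forall_inP=> f max_f; rewrite -negb_and; apply: contraNN neq.
by case/andP=> /eqP fu /eqP fv; apply/eqP/(uv f).
Qed.

Lemma gallai_rel_refl : reflexive gallai_rel.
Proof. by move=> u; rewrite /gallai_rel eqxx. Qed.

Lemma gallai_rel_sym : symmetric gallai_rel.
Proof.
by move=> u v; apply/gallai_relP/gallai_relP => uv f max_f fx fy;
   rewrite (uv f).
Qed.

Lemma gallai_rel_edge u v : u \in W -> v \in W -> e u v -> gallai_rel u v.
Proof.
move=> uW vW euv; apply/gallai_relP=> f max_f fu fv.
by have := maximum_matching_edge max_f fu uW vW euv; rewrite fv eqxx.
Qed.

Definition agreement M N := [set w in covered M | M w == N w].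

Lemma agreement_rematch M N x :
  matching W M -> matching W N -> M x != x -> N x = x ->
  agreement M N \proper agreement M (rematch N x (M x)).
Proof.
move=> /matchingP[MK _] /matchingP[NK _] Mx Nx.
apply/properP; split; last first.
  by exists x; rewrite !inE Mx ?ffunE ?eqxx ?Nx.
apply/subsetP=> w; rewrite !inE !ffunE => /andP[-> /eqP MN] /=.
have [->|wx] := eqVneq w x; first by [].
have [->|wMx] := eqVneq w (M x); first by rewrite MK.
have [wNMx|_] := eqVneq w (N (M x)); last by rewrite MN.
by move: wx; rewrite -(inj_eq (inv_inj MK)) MN wNMx NK eqxx.
Qed.

(* If the maximum matching [N] covers two vertices missed by [M], then [M]
   covers some [x != t] missed by [N]; switching [N] to the [M]-edge at [x]
   increases the agreement. *)
Lemma increase_agreement M N u v t :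
  maximum_matching W M -> maximum_matching W N ->
  u != v -> M u = u -> M v = v -> N u != u -> N v != v -> N t = t ->
  exists N', [/\ maximum_matching W N', N' t = t &
                #|agreement M N| < #|agreement M N'| ].
Proof.
move=> max_M max_N uv Mu Mv Nu Nv Nt.
have [[MW /eqP card_M] [NW /eqP card_N]] := (andP max_M, andP max_N).
have [||||x] := @exists_setD_neq _ (covered M) (covered N) u v t => //.
- by rewrite card_M card_N.
- by rewrite !inE Mu eqxx.
- by rewrite !inE Mv eqxx.
rewrite !inE negbK => /andP[/eqP Nx Mx] xt.
have [xW MxW exMx] := matching_edge MW Mx.
have NMx := maximum_matching_edge max_N Nx xW MxW exMx.
exists (rematch N x (M x)); split.
- exact: maximum_rematch.
- rewrite ffunE eq_sym (negbTE xt) Nt.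
  by have [tMx|_] := eqVneq t (M x); [rewrite -tMx Nt eqxx in NMx | case: ifP].
- exact/proper_card/agreement_rematch.
Qed.

(* Gallai's lemma: if a maximum matching [M] missed both [u] and [v], a maximum
   matching missing [t] that agrees as much as possible with [M] would cover [u]
   and [v]. *)
Lemma gallai_rel_trans u t v :
  (exists2 f, maximum_matching W f & f t = t) ->
  gallai_rel u t -> gallai_rel t v -> gallai_rel u v.
Proof.
case=> N0 max_N0 N0t /gallai_relP ut /gallai_relP tv.
apply/gallai_relP=> M max_M Mu Mv; apply/eqP; apply: contraT => uv.
have P_N0 : maximum_matching W N0 && (N0 t == t) by rewrite max_N0 N0t eqxx.
case: (@arg_maxnP _ N0 (fun N => maximum_matching W N && (N t == t))
         (fun N => #|agreement M N|) P_N0) => N /andP[max_N /eqP Nt] max_agree.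
have Nu : N u != u.
  apply: contra_neq uv => Nu; have ut_eq := ut N max_N Nu Nt.
  by rewrite ut_eq in Mu *; apply: (tv M).
have Nv : N v != v.
  apply: contra_neq uv => Nv; have tv_eq := tv N max_N Nt Nv.
  by rewrite -tv_eq in Mv *; apply: (ut M).
have [N' [max_N' N't lt_agree]] :=
  increase_agreement max_M max_N uv Mu Mv Nu Nv Nt.
suff: #|agreement M N'| <= #|agreement M N| by rewrite leqNgt lt_agree.
by apply: max_agree; rewrite max_N' N't eqxx.
Qed.

End MaximumMatching.

Section GallaiPartition.
Variable W : {set T}.
Hypothesis missable :
  {in W, forall x, exists2 f, maximum_matching W f & f x = x}.

Definition gallai_partition := equivalence_partition (gallai_rel W) W.

Lemma gallai_rel_equivalence : {in W & &, equivalence_rel (gallai_rel W)}.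
Proof.
move=> x y z xW yW _; split=> [|xy]; first exact: gallai_rel_refl.
apply/idP/idP; apply: gallai_rel_trans => //; try exact: missable.
by rewrite gallai_rel_sym.
Qed.

Lemma gallai_partitionP : partition gallai_partition W.
Proof. exact: equivalence_partitionP gallai_rel_equivalence. Qed.

Let trivP : trivIset gallai_partition.
Proof. by case/and3P: gallai_partitionP. Qed.

Lemma mem_gallai_block : {in W &, forall x y,
  (y \in pblock gallai_partition x) = gallai_rel W x y}.
Proof. exact: pblock_equivalence_partition gallai_rel_equivalence. Qed.

Lemma gallai_block_edge : {in W &, forall x y, e x y ->
  pblock gallai_partition x = pblock gallai_partition y}.
Proof.
move=> x y xW yW exy; apply/eqP.
rewrite eq_pblock ?(cover_partition gallai_partitionP) //.
by rewrite mem_gallai_block // gallai_rel_edge.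
Qed.

(* Pairwise related vertices have at most one unmatched vertex among them, and
   the matched ones are matched with each other. *)
Lemma gallai_block_covered f C :
  maximum_matching W f -> C \in gallai_partition ->
  (#|C|./2).*2 <= #|covered f :&: C|.
Proof.
move=> max_f CP; have /andP[fW _] := max_f; have /matchingP[fK _] := fW.
have sCW : {subset C <= W}.
  by apply/subsetP; rewrite -(cover_partition gallai_partitionP) bigcup_sup.
have even_C : ~~ odd #|covered f :&: C|.
  apply: (even_involution fK) => x /setIP[]; rewrite !inE // => fx xC.
  rewrite fK eq_sym fx /= -(def_pblock trivP CP xC).
  have [xW fxW exfx] := matching_edge fW fx.
  by rewrite mem_gallai_block // gallai_rel_edge.
have unmatched_le1 : #|C :\: covered f| <= 1.
  apply/card_le1_eqP=> x y; rewrite !inE !negbK.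
  case/andP=> /eqP fx xC /andP[/eqP fy yC].
  have /gallai_relP yx : gallai_rel W y x.
    by rewrite -mem_gallai_block ?sCW // (def_pblock trivP CP yC).
  exact: (yx f).
have := cardsID (covered f) C; rewrite setIC; lia.
Qed.

Lemma sum_half_gallai_partition :
  (\sum_(C in gallai_partition) #|C|./2).*2 <= max_covered W.
Proof.
have [f max_f] := maximum_matching_exists W.
have /andP[/matchingP[_ fW] /eqP <-] := max_f.
have sW : covered f \subset W by apply/subsetP=> x; rewrite inE => /fW[].
rewrite (card_partition_setI gallai_partitionP sW) -muln2 big_distrl /=.
by apply: leq_sum => C CP; rewrite muln2; apply: gallai_block_covered.
Qed.

End GallaiPartition.

Lemma max_covered_double W : (max_covered W)./2.*2 = max_covered W.
Proof.
have [f /andP[fW /eqP <-]] := maximum_matching_exists W.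
by rewrite (card_covered fW) doubleK.
Qed.

Lemma max_covered_setD1 W v :
  v \in W -> (forall f, maximum_matching W f -> f v != v) ->
  (max_covered (W :\ v)).+2 <= max_covered W.
Proof.
move=> vW cov_v.
have [g /andP[gWv /eqP card_g]] := maximum_matching_exists (W :\ v).
have /matchingP[gK ge] := gWv.
have gv : g v = v by apply: contraTeq isT => /ge[]; rewrite setD11.
have gW : matching W g by apply/matchingP; split=> // x /ge[/setD1P[]].
suff: #|covered g| < max_covered W.
  by rewrite card_g -max_covered_double -[max_covered W]max_covered_double; lia.
rewrite ltnNge; apply/negP=> /(maximum_matching_geq gW)/cov_v.
by rewrite gv eqxx.
Qed.

Definition separates W S P :=
  [/\ S \subset W, partition P (W :\: S) &
      {in W :\: S &, forall x y, e x y -> pblock P x = pblock P y}].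

Definition berge_weight S P := #|S| + \sum_(C in P) #|C|./2.

(* A vertex covered by every maximum matching is moved to [S]; once there is
   none left, the classes of [gallai_rel] are the blocks. *)
Lemma berge_tutte W :
  exists S P, separates W S P /\ (berge_weight S P).*2 <= max_covered W.
Proof.
have [n] := ubnP #|W|; elim: n W => // n IHn W card_W.
have [/exists_inP[v vW /forall_inP cov_v]|] :=
    boolP [exists v in W, [forall (f | maximum_matching W f), f v != v]].
  have [|S [P [[SWv parP edgeP] weight_le]]] := IHn (W :\ v).
    by move: card_W; rewrite (cardsD1 v) vW.
  have eqW : W :\: (v |: S) = (W :\ v) :\: S by rewrite setDDl.
  exists (v |: S), P; split; first split; rewrite ?eqW //.
    by rewrite subUset sub1set vW (subset_trans SWv) // subsetDl.
  have vS : v \notin S by apply/negP=> /(subsetP SWv); rewrite setD11.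
  have := max_covered_setD1 vW cov_v; move: weight_le.
  by rewrite /berge_weight cardsU1 vS; lia.
rewrite negb_exists_in => /forall_inP no_cov.
have missable : {in W, forall x, exists2 f, maximum_matching W f & f x = x}.
  move=> x /no_cov; rewrite negb_forall_in => /exists_inP[f max_f].
  by rewrite negbK => /eqP; exists f.
exists set0, (gallai_partition W); rewrite /berge_weight cards0 add0n; split.
  by split; rewrite ?sub0set ?setD0 //;
    [exact: gallai_partitionP | exact: gallai_block_edge].
exact: sum_half_gallai_partition.
Qed.

End Matching.

(** * Forbidden subgraphs and degree sums *)

Section ForbiddenSubgraphs.
Variables (T : finType) (e : rel T).
Hypotheses (sym : symmetric e) (irr : irreflexive e).

Definition closed_nbhd x := x |: [set y | e x y].

Lemma star_embedding k x : k <= deg e x ->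
  exists f : 'I_k.+1 -> T, [/\ injective f,
    forall i j, star_graph k i j -> e (f i) (f j) &
    forall i, f i \in closed_nbhd x].
Proof.
move=> le_k; pose leaf (j : 'I_k) := enum_val (widen_ord le_k j).
have e_leaf j : e x (leaf j).
  by have := enum_valP (widen_ord le_k j); rewrite inE.
have leaf_neq j : x <> leaf j.
  by move=> eq_x; move: (e_leaf j); rewrite -eq_x irr.
exists (fun i => oapp leaf x (unlift ord0 i)); split.
- move=> i j; case: unliftP => [i'|] ->; case: unliftP => [j'|] -> //=.
  + by move/enum_val_inj/(congr1 val) => /= eq_ij; congr lift; apply: val_inj.
  + by move/esym/leaf_neq.
  + by move/leaf_neq.
- rewrite /star_graph => i j.
  case: unliftP => [i'|] ->; case: unliftP => [j'|] -> //=.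
  by rewrite sym.
- by move=> i; case: unliftP => [i'|] _ /=; rewrite !inE ?eqxx ?e_leaf ?orbT.
Qed.

Lemma star_free_deg k x : ~ contains (star_graph k) e -> deg e x < k.
Proof.
move=> star_free; rewrite ltnNge; apply/negP=> /star_embedding[f [f_inj fe _]].
by apply: star_free; exists f.
Qed.

Lemma two_stars_free_meet k u v :
  ~ contains (two_stars_graph k) e -> k.-1 <= deg e u -> k.-1 <= deg e v ->
  ~~ [disjoint closed_nbhd u & closed_nbhd v].
Proof.
move=> stars_free.
move=> /star_embedding[f [f_inj fe fu]] /star_embedding[g [g_inj ge gv]].
apply/negP=> dis; case: stars_free.
have fg i j : f i <> g j.
  by move=> eq_fg; move: (gv j); rewrite -eq_fg (disjointFr dis).
exists (fun p => if p.1 then f p.2 else g p.2); split.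
  case=> [[] i] [[] j] /= => [/f_inj->|/fg|/esym/fg|/g_inj->] //.
by case=> [[] i] [[] j] //=; [apply: fe | apply: ge].
Qed.

Lemma matching_contains k W f :
  matching e W f -> k.*2 <= #|covered f| -> contains (matching_graph k) e.
Proof.
move=> fW; have /matchingP[fK fe] := fW.
rewrite (card_covered fW) leq_double => le_k.
pose g (i : 'I_k) := enum_val (widen_ord le_k i).
have g_root i : froots f (g i) && (f (g i) != g i).
  by have := enum_valP (widen_ord le_k i); rewrite !inE.
have g_inj : injective g by move=> i j /enum_val_inj/(congr1 val) /= /val_inj.
have g_neq i j : g i <> f (g j).
  move=> gij; have /andP[/eqP root_i _] := g_root i.
  have /andP[/eqP root_j /eqP[]] := g_root j.
  rewrite -gij -root_i -[RHS]root_j gij; apply/esym/(rootP _ _).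
    exact/fconnect_sym/(inv_inj fK).
  exact: fconnect1.
exists (fun p : 'I_k * bool => if p.2 then g p.1 else f (g p.1)); split.
  move=> [i []] [j []] /=.
  - by move/g_inj->.
  - by move/g_neq.
  - by move/esym/g_neq.
  - by move/(inv_inj fK)/g_inj->.
move=> [i a] [j b] /andP[/= /eqP <-].
have /andP[_ /fe[_ e_i]] := g_root i.
by case: a b => [] [] //= _; rewrite sym.
Qed.

Lemma matching_free_separates k : ~ contains (matching_graph k) e ->
  exists S P, separates e setT S P /\ berge_weight S P < k.
Proof.
move=> matching_free; have [S [P [sep weight_le]]] := berge_tutte sym irr setT.
exists S, P; split=> //; rewrite ltnNge; apply/negP=> ge_k.
apply: matching_free.
have [f /andP[fT /eqP max_f]] := maximum_matching_exists e setT.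
apply: (matching_contains fT); rewrite max_f.
by apply: leq_trans weight_le; rewrite leq_double.
Qed.

End ForbiddenSubgraphs.

Section DegreeSums.
Variables (T : finType) (e : rel T).
Hypotheses (sym : symmetric e) (irr : irreflexive e).
Implicit Types (A C S W : {set T}) (P : {set {set T}}).

Definition deg_in A x := #|[set y in A | e x y]|.

Definition narcs A :=
  #|[set p : T * T | [&& p.1 \in A, p.2 \in A & e p.1 p.2]]|.

Definition clique C := [forall x in C, forall y in C, e x y == (x != y)].

Lemma cliqueP C :
  reflect {in C &, forall x y, e x y = (x != y)} (clique C).
Proof.
apply: (iffP forall_inP) => [adjC x y xC yC|adjC x xC].
  exact/eqP/(forall_inP (adjC x xC)).
by apply/forall_inP=> y yC; rewrite adjC.
Qed.

Lemma deg_inE A x : deg_in A x = \sum_(y in A) e x y.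
Proof.
rewrite /deg_in -sum1_card [RHS]big_mkcond [LHS]big_mkcond.
by apply: eq_bigr => y _; rewrite inE; case: (y \in A); case: (e x y).
Qed.

Lemma deg_inT x : deg_in setT x = deg e x.
Proof. by apply: eq_card => y; rewrite !inE. Qed.

Lemma deg_in_le A x : deg_in A x <= deg e x.
Proof. by apply/subset_leq_card/subsetP=> y; rewrite !inE => /andP[]. Qed.

Lemma deg_in_setC S x : deg_in S x + deg_in (~: S) x = deg e x.
Proof.
rewrite -deg_inT !deg_inE [RHS](bigID (mem S)) /=; congr (_ + _);
  by apply: eq_bigl => y; rewrite !inE.
Qed.

Lemma deg_in_leqif C x : x \in C ->
  deg_in C x <= #|C|.-1 ?= iff [forall y in C, e x y == (x != y)].
Proof.
move=> xC; have sub : [set y in C | e x y] \subset C :\ x.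
  apply/subsetP=> y; rewrite !inE => /andP[->].
  by case: eqVneq => // ->; rewrite irr.
have := subset_leqif_cards sub.
rewrite (cardsD1 x C) xC add1n /= -/(deg_in C x).
congr (_ <= _ ?= iff _); apply/eqP/forall_inP => [/setP eqC y yC | eqC].
  by have := eqC y; rewrite !inE yC andbT eq_sym /= => ->.
apply/setP=> y; rewrite !inE; case yC: (y \in C); rewrite ?andbF //=.
by rewrite (eqP (eqC y yC)) andbT eq_sym.
Qed.

Lemma sum_deg_inC A B : \sum_(x in A) deg_in B x = \sum_(x in B) deg_in A x.
Proof.
under eq_bigr do rewrite deg_inE; under [RHS]eq_bigr do rewrite deg_inE.
rewrite exchange_big; apply: eq_bigr => x _; apply: eq_bigr => y _.
by rewrite sym.
Qed.

Lemma narcsE A : narcs A = \sum_(x in A) deg_in A x.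
Proof.
under [RHS]eq_bigr do rewrite deg_inE.
rewrite /narcs pair_big /= -sum1_card big_mkcond [RHS]big_mkcond.
apply: eq_bigr => -[x y] _ /=; rewrite inE /=.
by case: (x \in A); case: (y \in A); case: (e x y).
Qed.

Lemma narcsT : narcs setT = \sum_x deg e x.
Proof. by rewrite narcsE; apply: eq_big => [x|x _]; rewrite ?inE ?deg_inT. Qed.

Lemma narcs_setC S :
  narcs setT = \sum_(x in S) (deg e x + deg_in (~: S) x) + narcs (~: S).
Proof.
rewrite narcsT (bigID (mem S)) /= big_split -addnA; congr (_ + _).
rewrite sum_deg_inC narcsE -big_split /=.
by apply: eq_big => [x|x _]; rewrite ?inE ?deg_in_setC.
Qed.

Lemma even_narcs A : ~~ odd (narcs A).
Proof.
rewrite /narcs; apply: (@even_involution _ (fun p : T * T => (p.2, p.1))).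
- by case.
- by move=> [x y]; rewrite !inE /= sym => /and3P[-> -> ->].
- move=> [x y]; rewrite inE => /and3P[_ _ /= exy].
  by apply: contraTneq exy => -[->]; rewrite irr.
Qed.

Lemma handshake : narcs setT = (nedges e).*2.
Proof.
rewrite /narcs -sum1_card /nedges; set E := imset2 _ _ _.
rewrite (partition_big (fun p => [set p.1; p.2]) (mem E)) /=; last first.
  by move=> [x y]; rewrite !inE => exy; apply/imset2P; exists x y; rewrite ?inE.
rewrite -muln2 -sum_nat_const; apply: eq_bigr => _ /imset2P[x y _ + ->].
rewrite inE => /= exy.
have xy : x != y by apply: contraTneq exy => ->; rewrite irr.
have <- : #|[set (x, y); (y, x)]| = 2 by rewrite cards2 xpair_eqE negb_and xy.
rewrite sum1dep_card; apply: eq_card => -[a b]; rewrite !inE /= !xpair_eqE.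
apply/andP/orP => [[eab /eqP eq_set] | [] /andP[/eqP-> /eqP->]].
- have : a \in [set x; y] by rewrite -eq_set set21.
  have : b \in [set x; y] by rewrite -eq_set set22.
  rewrite !inE => /orP[]/eqP eb /orP[]/eqP ea; move: eab.
  + by rewrite ea eb irr.
  + by right; rewrite ea eb !eqxx.
  + by left; rewrite ea eb !eqxx.
  + by rewrite ea eb irr.
- by [].
- by rewrite sym setUC.
Qed.

Lemma narcs_le C m : {in C, forall x, deg e x <= m} -> narcs C <= #|C| * m.
Proof.
move=> le_m; rewrite narcsE -sum_nat_const; apply: leq_sum => x xC.
exact: leq_trans (deg_in_le C x) (le_m x xC).
Qed.

Lemma narcs_leqif C :
  narcs C <= #|C| * #|C|.-1 ?= iff clique C.
Proof.
by rewrite narcsE -sum_nat_const; apply: leqif_sum => x xC; apply: deg_in_leqif.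
Qed.

Section Separates.
Variables (W S : {set T}) (P : {set {set T}}).
Hypothesis sep : separates e W S P.

Let parP : partition P (W :\: S). Proof. by case: sep. Qed.
Let trivP : trivIset P. Proof. by case/and3P: parP. Qed.

Lemma block_subset C : C \in P -> {subset C <= W :\: S}.
Proof.
by move=> CP; apply/subsetP; rewrite -(cover_partition parP) bigcup_sup.
Qed.

Lemma block_closed C x y :
  C \in P -> x \in C -> e x y -> y \in W :\: S -> y \in C.
Proof.
move=> CP xC exy yWS; case: sep => _ _ edgeP.
rewrite -(def_pblock trivP CP xC) (edgeP x y) ?(block_subset CP xC) //.
by rewrite mem_pblock (cover_partition parP).
Qed.

Lemma block_eq C1 C2 x :
  C1 \in P -> C2 \in P -> x \in C1 -> x \in C2 -> C1 = C2.
Proof.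
move=> C1P C2P xC1 xC2.
by rewrite -(def_pblock trivP C1P xC1) (def_pblock trivP C2P).
Qed.

Lemma narcs_separates : narcs (W :\: S) = \sum_(C in P) narcs C.
Proof.
rewrite narcsE (set_partition_big _ parP) /=; apply: eq_bigr => C CP.
rewrite narcsE; apply: eq_bigr => x xC; apply: eq_card => y; rewrite !inE.
apply/andP/andP=> -[yC exy]; split=> //.
  by apply: (block_closed CP xC exy); rewrite inE.
by have := block_subset CP yC; rewrite inE.
Qed.

End Separates.

End DegreeSums.

(** * Extremal graphs *)

Section Deficiency.
Variables (T : finType) (e : rel T) (d : nat).
Hypothesis sym : symmetric e.
Hypothesis max_deg : forall x, deg e x <= d.
Implicit Types C : {set T}.

Definition deficiency C := \sum_(x in C) (d - deg_in e C x).

Definition deficient C := [set x in C | deg_in e C x != d].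

Lemma deg_in_max C x : deg_in e C x <= d.
Proof. exact: leq_trans (deg_in_le e C x) (max_deg x). Qed.

Lemma deficiencyE C : deficiency C + narcs e C = #|C| * d.
Proof.
rewrite narcsE -big_split /= -sum_nat_const; apply: eq_bigr => x _.
by rewrite subnK ?deg_in_max.
Qed.

Lemma card_deficient C : #|deficient C| <= deficiency C.
Proof.
rewrite -sum1dep_card big_mkcondr; apply: leq_sum => x _.
by have := deg_in_max C x; case: eqP => //=; lia.
Qed.

Lemma deg_in_max_mem C x y : deg_in e C x = d -> e x y -> y \in C.
Proof.
move=> full_x exy; apply: contraT => yC.
have := deg_in_setC e C x; rewrite full_x => deg_x.
have : 0 < deg_in e (~: C) x by apply/card_gt0P; exists y; rewrite !inE yC.
by have := max_deg x; lia.
Qed.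

Definition almost_regular_component C :=
  [/\ closed e C, {in C, forall x, deg e x = d \/ deg e x = d.-1} &
      #|[set x in C | deg e x != d]| <= 1].

Lemma deficiency_almost_regular C :
  closed e C -> deficiency C <= 1 -> almost_regular_component C.
Proof.
move=> closedC deficiency_le1.
have deg_inC x : x \in C -> deg_in e C x = deg e x.
  move=> xC; apply: eq_card => y; rewrite !inE andb_idl // => exy.
  by rewrite -(closedC x y exy).
split=> // [x xC|].
  rewrite -deg_inC //; move: deficiency_le1; rewrite /deficiency (bigD1 x) //=.
  by have := deg_in_max C x; lia.
apply: leq_trans deficiency_le1; apply: leq_trans (card_deficient C).
apply/subset_leq_card/subsetP=> x; rewrite !inE => /andP[xC].
by rewrite xC deg_inC.
Qed.

Section MeetingNeighbourhoods.
Variables (C : {set T}) (u : T).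
Hypothesis meet_u : forall v, deg e u = d -> deg e v = d ->
  ~~ [disjoint closed_nbhd e u & closed_nbhd e v].
Hypothesis uC : u \notin C.

Lemma common_deficient_nbr w :
  deg e u = d -> w \in C -> w \notin deficient C ->
  exists z, [/\ z \in deficient C, e u z & z \in closed_nbhd e w].
Proof.
move=> deg_u wC; rewrite inE wC negbK => /eqP full_w.
have deg_w : deg e w = d.
  by have := deg_in_le e C w; have := max_deg w; lia.
have /pred0Pn[z /andP[/= zu zw]] := meet_u deg_u deg_w.
have zC : z \in C.
  by move: zw; rewrite !inE => /orP[/eqP->|/(deg_in_max_mem full_w)].
have euz : e u z.
  by move: zu uC; rewrite !inE => /orP[/eqP <-|//]; rewrite zC.
exists z; split=> //; rewrite inE zC; apply: contraNneq uC => full_z.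
by apply: (deg_in_max_mem full_z); rewrite sym.
Qed.

(* The closed neighbourhood of [u] would meet that of every full vertex of [C]
   in the only deficient vertex of [C], which would then be adjacent to [u] and
   to all the other vertices of [C]. *)
Lemma deg_lt_outside :
  1 < #|C| -> d < #|C| -> deficiency C <= 1 -> deg e u < d.
Proof.
move=> card_gt1 card_gtd deficiency_le1.
rewrite ltn_neqAle max_deg andbT; apply/eqP=> deg_u.
have deficient_le1 : #|deficient C| <= 1.
  exact: leq_trans (card_deficient C) deficiency_le1.
have [w wC full_w] : exists2 w, w \in C & w \notin deficient C.
  by apply/subsetPn; apply: contraL card_gt1 => /subset_leq_card; lia.
have [z [z_def euz _]] := common_deficient_nbr deg_u wC full_w.
have zC : z \in C by move: z_def; rewrite inE => /andP[].
have sub : u |: (C :\ z) \subset [set y | e z y].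
  apply/subsetP=> y; rewrite !inE => /orP[/eqP->|/andP[yz yC]].
    by rewrite sym.
  have full_y : y \notin deficient C.
    by apply: contraNN yz => y_def; apply/eqP/(card_le1_eqP deficient_le1).
  have [z' [z'_def _]] := common_deficient_nbr deg_u yC full_y.
  rewrite (card_le1_eqP deficient_le1 z z') // !inE [z == y]eq_sym.
  by rewrite (negbTE yz) sym.
have := leq_trans (subset_leq_card sub) (max_deg z).
rewrite cardsU1 !inE (negbTE uC) andbF /=.
by move: card_gtd; rewrite (cardsD1 z C) zC; lia.
Qed.

End MeetingNeighbourhoods.

End Deficiency.

Section ExtremalGraphs.
Variables (T : finType) (e : rel T) (d : nat).
Hypotheses (sym : symmetric e) (irr : irreflexive e).
Hypothesis max_deg : forall x, deg e x <= d.
Hypothesis full_nbhds_meet : forall u v, deg e u = d -> deg e v = d ->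
  ~~ [disjoint closed_nbhd e u & closed_nbhd e v].
Implicit Types C : {set T}.

Definition big_block C := odd #|C| && (d < #|C|).

Definition block_bound C := (d * #|C|./2 + big_block C * d./2).*2.

Lemma narcs_le_block C : narcs e C <= block_bound C.
Proof.
have le_max : narcs e C <= #|C| * d by apply: narcs_le => x _.
have [le_clique _] := narcs_leqif irr C.
have := even_narcs sym irr C; rewrite /block_bound /big_block.
have := odd_double_half #|C|; move: #|C|./2 => h.
case: (odd #|C|) => /= card_C; last by rewrite -card_C in le_max; lia.
case: ltnP => [_|card_le] /=; first by rewrite -card_C in le_max; lia.
by rewrite -card_C in card_le le_clique; nia.
Qed.

Lemma deficiency_big_block C :
  big_block C -> narcs e C = block_bound C -> deficiency e d C <= 1.
Proof.
move=> bigC tight; have := deficiencyE max_deg C.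
rewrite tight /block_bound bigC; have := odd_double_half d.
have := odd_double_half #|C|; case/andP: bigC => -> _ /=.
by case: (odd d); nia.
Qed.

Lemma tight_small_block C :
  {in C, forall x, deg e x < d} -> ~~ big_block C -> 1 < #|C| ->
  narcs e C = block_bound C -> [/\ odd d, #|C| = d & clique e C].
Proof.
move=> small_deg not_big card_gt1; rewrite /block_bound (negbTE not_big) addn0.
move=> tight.
have d_gt0 : 0 < d by have /card_gt0P[x /small_deg] := ltnW card_gt1; lia.
have lt_max : narcs e C <= #|C| * d.-1 by apply: narcs_le => x /small_deg; lia.
have [le_clique eq_clique] := narcs_leqif irr C.
have half_C := odd_double_half #|C|; move: not_big; rewrite /big_block.
case oddC : (odd #|C|) half_C => /= half_C; last by exfalso; nia.
rewrite -leqNgt => card_le; have card_C : #|C| = d by nia.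
split=> //; first by rewrite -card_C.
rewrite -eq_clique tight card_C doubleMr; apply/eqP; congr (_ * _).
by move: half_C; rewrite card_C; lia.
Qed.

Variables (S : {set T}) (P : {set {set T}}).
Hypothesis sep : separates e setT S P.

Definition big_blocks := [set C in P | big_block C].

Lemma block_component C : S = set0 -> C \in P -> closed e C.
Proof.
move=> S0 CP x y exy; have inT z : z \in setT :\: S by rewrite S0 !inE.
apply/idP/idP => [xC|yC]; first exact: (block_closed sep CP xC exy (inT y)).
by apply: (block_closed sep CP yC _ (inT x)); rewrite sym.
Qed.

Lemma narcs_leqif_blocks :
  narcs e setT <= (d * berge_weight S P + #|big_blocks| * d./2).*2
    ?= iff [forall x in S, deg_in e (~: S) x == d]
           && [forall C in P, narcs e C == block_bound C].
Proof.
rewrite (narcs_setC sym S) -setTD (narcs_separates sep).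
have -> : (d * berge_weight S P + #|big_blocks| * d./2).*2
          = \sum_(x in S) d.*2 + \sum_(C in P) block_bound C.
  have -> : #|big_blocks| = \sum_(C in P) big_block C.
    by rewrite -sum1dep_card big_mkcondr.
  rewrite /berge_weight sum_nat_const /block_bound.
  under [X in _ = _ + X]eq_bigr do rewrite -muln2.
  by rewrite -big_distrl big_split -big_distrr -big_distrl /=; lia.
apply: leqif_add; last first.
  by apply: leqif_sum => C _; apply/leqif_eq/narcs_le_block.
apply: leqif_sum => x _; rewrite setTD.
have := deg_in_le e (~: S) x; have := max_deg x.
by split; [lia | apply/eqP/eqP; lia].
Qed.

Hypothesis weight_le : berge_weight S P <= d.

Section TwoBigBlocks.
Variables C1 C2 : {set T}.
Hypotheses (d_gt1 : 1 < d) (C1P : C1 \in P) (C2P : C2 \in P) (C12 : C1 != C2).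
Hypotheses (big_C1 : big_block C1) (big_C2 : big_block C2).

Lemma two_big_blocks_shape :
  [/\ S = set0, ~~ odd d, #|C1| = d.+1 & #|C2| = d.+1] /\
  narcs e setT = narcs e C1 + narcs e C2.
Proof.
have [[odd_C1 gt_C1] [odd_C2 gt_C2]] := (andP big_C1, andP big_C2).
pose R := \sum_(C in P | (C != C1) && (C != C2)) #|C|./2.
have weightE : #|S| + (#|C1|./2 + (#|C2|./2 + R)) <= d.
  by move: weight_le; rewrite /berge_weight (bigD2 _ _ C1P C2P C12) /=.
have [[S0 R0] [even_d card_C1 card_C2]] :
    (#|S| = 0 /\ R = 0) /\ [/\ ~~ odd d, #|C1| = d.+1 & #|C2| = d.+1].
  by split; split; lia.
have {}S0 : S = set0 by apply/eqP; rewrite -cards_eq0 S0.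
split=> //; rewrite -[setT]setD0 -S0 (narcs_separates sep).
rewrite (bigD2 _ _ C1P C2P C12) /= big1 ?addn0 // => C /and3P[CP CC1 CC2].
have card_le1 : #|C| <= 1.
  rewrite leqNgt -half_gt0 -eqn0Ngt -leqn0 -R0 /R.
  by rewrite (bigD1 C) ?CP ?CC1 //= leq_addr.
have [+ _] := narcs_leqif irr C.
have -> : #|C| * #|C|.-1 = 0 by case: #|C| card_le1 => [|[]].
by rewrite leqn0 => /eqP.
Qed.

Lemma big_block_deg_lt :
  {in C1, forall x, deg e x < d} \/ {in C2, forall x, deg e x < d}.
Proof.
have [/forall_inP|] := boolP [forall x in C1, deg e x < d]; first by left.
have [/forall_inP|] := boolP [forall x in C2, deg e x < d]; first by right.
rewrite !negb_forall_in => /exists_inP[v vC2 ge_v] /exists_inP[u uC1 ge_u].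
have deg_u : deg e u = d by have := max_deg u; lia.
have deg_v : deg e v = d by have := max_deg v; lia.
have [[S0 _ _ _] _] := two_big_blocks_shape.
have nbhd_block C x z : C \in P -> x \in C -> z \in closed_nbhd e x -> z \in C.
  move=> CP xC; rewrite !inE => /orP[/eqP->//|exz].
  by rewrite -(block_component S0 CP exz).
have /pred0Pn[z /andP[/= zu zv]] := full_nbhds_meet deg_u deg_v.
case/eqP: C12; apply: (block_eq sep C1P C2P (x := z)).
- exact: nbhd_block zu.
- exact: nbhd_block zv.
Qed.

Lemma narcs_two_big_blocks_lt : narcs e setT < (d * d + d./2).*2.
Proof.
have [[_ even_d card_C1 card_C2] ->] := two_big_blocks_shape.
have le_max C : #|C| = d.+1 -> narcs e C <= d.+1 * d.
  by move=> <-; apply: narcs_le.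
have lt_max C :
    #|C| = d.+1 -> {in C, forall x, deg e x < d} -> narcs e C <= d.+1 * d.-1.
  by move=> <- deg_lt; apply: narcs_le => x /deg_lt; lia.
have lt_sqr : d.+1 * d.-1 < d * d by rewrite -(ltn_predK d_gt1); lia.
rewrite doubleD even_halfK //; have [le_C1 le_C2] := (le_max C1, le_max C2).
by case: big_block_deg_lt => /lt_max; lia.
Qed.

End TwoBigBlocks.

Lemma card_big_blocks :
  1 < d -> (d * d + d./2).*2 <= narcs e setT -> #|big_blocks| <= 1.
Proof.
move=> d_gt1 ge_narcs; rewrite leqNgt; apply/card_gt1P=> -[C1 [C2 []]].
rewrite !inE => /andP[C1P big_C1] /andP[C2P big_C2] C12.
have := narcs_two_big_blocks_lt d_gt1 C1P C2P C12 big_C1 big_C2.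
by rewrite ltnNge ge_narcs.
Qed.

Lemma narcs_le_sqr : narcs e setT <= (d * d + d./2).*2.
Proof.
have [le_blocks _] := narcs_leqif_blocks.
have weight_bound := leq_mul (leqnn d) weight_le.
have [d_le1|d_gt1] := leqP d 1.
  have half_d : d./2 = 0 by lia.
  by rewrite half_d in le_blocks *; lia.
rewrite leqNgt; apply/negP=> gt_narcs.
have := leq_mul (card_big_blocks d_gt1 (ltnW gt_narcs)) (leqnn d./2); lia.
Qed.

Hypothesis d_gt1 : 1 < d.
Hypothesis extremal : narcs e setT = (d * d + d./2).*2.

Let big_blocks_le1 : #|big_blocks| <= 1.
Proof. by apply: (card_big_blocks d_gt1); rewrite extremal. Qed.

Lemma extremal_blocks :
  [/\ berge_weight S P = d, {in S, forall x, deg e x = d} &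
      {in P, forall C, narcs e C = block_bound C}].
Proof.
have [le_blocks eq_blocks] := narcs_leqif_blocks.
have weight_bound := leq_mul (leqnn d) weight_le.
have big_bound := leq_mul big_blocks_le1 (leqnn d./2).
move: eq_blocks; rewrite extremal in le_blocks *.
have -> : (d * d + d./2).*2 == (d * berge_weight S P + #|big_blocks| * d./2).*2.
  by apply/eqP; lia.
case/esym/andP=> /forall_inP tightS /forall_inP tightP.
split=> [|x xS|C CP].
- by apply/eqP; rewrite eqn_leq weight_le -(leq_pmul2l (ltnW d_gt1)); lia.
- have := deg_in_le e (~: S) x; rewrite (eqP (tightS x xS)).
  by have := max_deg x; lia.
- exact/eqP/tightP.
Qed.

Lemma extremal_big_block :
  exists2 C0, C0 \in P &
    big_block C0 /\ {in P, forall C, big_block C -> C = C0}.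
Proof.
have /card_gt0P[C0] : 0 < #|big_blocks|.
  rewrite lt0n; apply/eqP=> no_big; have [le_blocks _] := narcs_leqif_blocks.
  have := leq_mul (leqnn d) weight_le; rewrite extremal no_big in le_blocks.
  by have := odd_double_half d; lia.
rewrite inE => /andP[C0P big_C0]; exists C0 => //; split=> // C CP bigC.
by apply: (card_le1_eqP big_blocks_le1); rewrite inE ?C0P ?CP.
Qed.

Section BigBlock.
Variable C0 : {set T}.
Hypotheses (C0P : C0 \in P) (big_C0 : big_block C0).
Hypothesis big_uniq : {in P, forall C, big_block C -> C = C0}.

Lemma deficiency_big_block_le1 : deficiency e d C0 <= 1.
Proof.
have [_ _ tight] := extremal_blocks.
exact: deficiency_big_block (tight _ C0P).
Qed.

Lemma deg_lt_outside_big_block x : x \notin C0 -> deg e x < d.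
Proof.
have /andP[_ card_gtd] := big_C0; have card_gt1 := ltn_trans d_gt1 card_gtd.
move=> xC0; apply: deg_lt_outside xC0 card_gt1 card_gtd _ => //.
  exact: full_nbhds_meet.
exact: deficiency_big_block_le1.
Qed.

Lemma extremal_separator0 : S = set0.
Proof.
have [_ degS _] := extremal_blocks; apply/eqP; apply: contraT => /set0Pn[u uS].
have : u \notin C0.
  by apply/negP=> /(block_subset sep C0P); rewrite setTD inE uS.
by move/deg_lt_outside_big_block; rewrite degS ?ltnn.
Qed.

Lemma extremal_block_component C : C \in P -> closed e C.
Proof. exact: block_component extremal_separator0. Qed.

Lemma big_block_almost_regular : almost_regular_component e d C0.
Proof.
apply: deficiency_almost_regular => //; first exact: extremal_block_component.
exact: deficiency_big_block_le1.
Qed.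

Lemma extremal_small_block C :
  C \in P -> C != C0 -> 1 < #|C| -> [/\ odd d, #|C| = d & clique e C].
Proof.
move=> CP CC0 card_gt1; have [_ _ tight] := extremal_blocks.
apply: tight_small_block => //; last exact: tight.
- move=> x xC; apply: deg_lt_outside_big_block; apply: contraNN CC0 => xC0.
  by rewrite (block_eq sep CP C0P xC xC0).
- by apply: contraNN CC0 => /(big_uniq CP) ->.
Qed.

Lemma non_isolated_block x :
  x \in non_isolated e -> exists C, [/\ C \in P, x \in C & 1 < #|C| ].
Proof.
rewrite inE => /existsP[y exy]; have [_ parP _] := sep.
have : x \in cover P by rewrite (cover_partition parP) extremal_separator0 !inE.
case/bigcupP=> C CP xC; exists C; split=> //; apply/card_gt1P; exists x, y.
split=> //; first by rewrite -(extremal_block_component CP exy).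
by apply: contraTneq exy => ->; rewrite irr.
Qed.

End BigBlock.

Definition clique_beside C C' :=
  [/\ [disjoint C & C'], non_isolated e \subset C :|: C' & clique e C'].

Lemma extremal_components :
  exists2 C, almost_regular_component e d C &
    (#|C| = d.*2.+1 /\ non_isolated e \subset C) \/
    [/\ odd d, #|C| = d.+2 &
        exists2 C' : {set T}, #|C'| = d & clique_beside C C'].
Proof.
have [C0 C0P [big_C0 big_uniq]] := extremal_big_block.
exists C0; first exact: big_block_almost_regular.
have /andP[odd_C0 gt_C0] := big_C0.
have [weightE _ _] := extremal_blocks.
rewrite /berge_weight (extremal_separator0 C0P big_C0) cards0 add0n in weightE.
have [/exists_inP[C' C'P /andP[C'C0 C'_gt1]]|no_other] :=
    boolP [exists C in P, (C != C0) && (1 < #|C|)]; last first.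
  have other_le1 C : C \in P -> C != C0 -> #|C| <= 1.
    move=> CP CC0; rewrite leqNgt; apply: contraNN no_other => C_gt1.
    by apply/exists_inP; exists C; rewrite ?CC0.
  left; split.
    have others0 : \sum_(C in P | C != C0) #|C|./2 = 0.
      by apply: big1 => C /andP[CP /(other_le1 C CP)]; lia.
    by move: weightE; rewrite (bigD1 C0) //= others0; lia.
  apply/subsetP=> x /(non_isolated_block C0P big_C0)[C [CP xC C_gt1]].
  by have [<-//|/(other_le1 C CP)] := eqVneq C C0; rewrite leqNgt C_gt1.
have [odd_d card_C' clique_C'] :=
  extremal_small_block C0P big_C0 big_uniq C'P C'C0 C'_gt1.
pose R := \sum_(C in P | (C != C') && (C != C0)) #|C|./2.
have {}weightE : #|C'|./2 + (#|C0|./2 + R) = d.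
  by rewrite -weightE (bigD2 _ _ C'P C0P C'C0).
have [card_C0 R0] : #|C0| = d.+2 /\ R = 0 by lia.
right; split=> //; exists C' => //; split=> //.
  rewrite -setI_eq0; apply: contraNT C'C0 => /set0Pn[x /setIP[xC0 xC']].
  by rewrite (block_eq sep C0P C'P xC0 xC').
apply/subsetP=> x /(non_isolated_block C0P big_C0)[C [CP xC C_gt1]].
rewrite inE.
have [<-|CC0] := eqVneq C C0; first by rewrite xC.
have [<-|CC'] := eqVneq C C'; first by rewrite xC orbT.
have : #|C|./2 <= R by rewrite /R (bigD1 C) ?CP ?CC0 ?CC' //= leq_addr.
by rewrite R0 leqNgt half_gt0 C_gt1.
Qed.

End ExtremalGraphs.

(** * Isomorphism up to isolated vertices *)

Lemma g1S d : g1 d.+1 = d * d + d./2.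
Proof.
rewrite /g1 /= subn1 /=; have := odd_double_half d; move: d./2 => m.
case: (odd d) => /= <-.
  by rewrite (_ : _ * _ = (m.+1 * (4 * m + 1)) * 2) ?mulnK //; lia.
by rewrite (_ : _ * _ = (m * (4 * m + 1)) * 2) ?mulnK //; lia.
Qed.

Lemma nedges_almost_regular (U : finType) (r : rel U) d :
  simple_graph r -> almost_regular r d -> nedges r = (#|U| * d)./2.
Proof.
move=> [sym irr] [deg_r deficient_le1].
have deficiency_le1 : \sum_x (d - deg r x) <= 1.
  apply: leq_trans deficient_le1; rewrite -sum1dep_card [X in _ <= X]big_mkcond.
  by apply: leq_sum => x _; case: (deg_r x) => ->; case: eqP => /= *; lia.
have : \sum_x (d - deg r x) + (nedges r).*2 = #|U| * d.
  rewrite -(handshake sym irr) narcsT -big_split -sum_nat_const.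
  by apply: eq_bigr => x _ /=; case: (deg_r x) => ->; lia.
by lia.
Qed.

Section UnionWithClique.
Variables (m n : nat) (r : rel 'I_m).

Lemma deg_union_inl i : deg (union_with_clique n r) (inl i) = deg r i.
Proof.
rewrite /deg -[RHS](card_imset _ (@inl_inj 'I_m 'I_n)).
apply: eq_card => -[j|j].
  by rewrite (mem_imset _ _ (@inl_inj _ _)) !inE.
by rewrite inE; apply/esym/negP=> /imsetP[].
Qed.

Lemma deg_union_inr i : deg (union_with_clique n r) (inr i) = n.-1.
Proof.
have <- : #|[set~ i]| = n.-1 by rewrite cardsC1 card_ord.
rewrite /deg -[RHS](card_imset _ (@inr_inj 'I_m 'I_n)).
apply: eq_card => -[j|j].
  by rewrite inE; apply/esym/negP=> /imsetP[].
by rewrite (mem_imset _ _ (@inr_inj _ _)) !inE eq_sym.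
Qed.

Hypothesis simple_r : simple_graph r.

Lemma union_with_clique_simple : simple_graph (union_with_clique n r).
Proof.
case: simple_r => sym irr.
by split=> [[i|i] [j|j]|[i|i]] //=; rewrite ?sym ?irr ?eqxx // eq_sym.
Qed.

Lemma nedges_union_with_clique :
  nedges (union_with_clique n r) = nedges r + 'C(n, 2).
Proof.
have [[symr irrr] [symu irru]] := (simple_r, union_with_clique_simple).
apply: double_inj; rewrite doubleD -!handshake // !narcsT big_sumType /=.
under eq_bigr do rewrite deg_union_inl.
under [X in _ + X]eq_bigr do rewrite deg_union_inr.
by rewrite sum_nat_const card_ord -[in RHS]mul2n mul_bin_left bin1 subn1 mulnC.
Qed.

End UnionWithClique.

Lemma mem_non_isolated (T : finType) (e : rel T) x :
  (x \in non_isolated e) = (0 < deg e x).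
Proof.
rewrite inE; apply/existsP/card_gt0P => -[y exy]; exists y.
  by rewrite inE.
by rewrite inE in exy.
Qed.

Lemma edge_non_isolated (T : finType) (e : rel T) x y :
  symmetric e -> e x y -> x \in non_isolated e /\ y \in non_isolated e.
Proof.
move=> sym exy; rewrite !inE; split; apply/existsP; first by exists y.
by exists x; rewrite sym.
Qed.

Lemma iso_upto_isolated_subset (T U : finType) (e : rel T) (h : rel U)
    (f : T -> U) :
  symmetric e -> {in non_isolated e &, injective f} ->
  {in non_isolated e &, forall x y, h (f x) (f y) = e x y} ->
  non_isolated h \subset f @: non_isolated e -> iso_upto_isolated e h.
Proof.
move=> sym f_inj fe sub; exists f; split=> //; split=> //.
apply/eqP; rewrite eqEsubset sub andbT; apply/subsetP=> _ /imsetP[x xN ->].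
have := xN; rewrite inE => /existsP[y exy].
have [_ yN] := edge_non_isolated sym exy.
by rewrite inE; apply/existsP; exists (f y); rewrite fe.
Qed.

Lemma iso_nedges (T U : finType) (e : rel T) (h : rel U) :
  simple_graph e -> simple_graph h -> iso_upto_isolated e h ->
  nedges e = nedges h.
Proof.
move=> [syme irre] [symh irrh] [f [f_inj [fe f_im]]].
apply: double_inj; rewrite -!handshake // /narcs.
rewrite -(card_in_imset (f := fun p => (f p.1, f p.2))); last first.
  move=> [x y] [x' y']; rewrite !inE /= => exy exy' [eqx eqy].
  have [xN yN] := edge_non_isolated syme exy.
  have [xN' yN'] := edge_non_isolated syme exy'.
  by rewrite (f_inj x x') // (f_inj y y').
apply: eq_card => -[u v]; rewrite !inE /=; apply/imsetP/idP => [[[x y]]|huv].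
  rewrite !inE /= => exy [-> ->]; have [xN yN] := edge_non_isolated syme exy.
  by rewrite fe.
have := edge_non_isolated symh huv; rewrite -f_im.
case=> /imsetP[x xN eq_u] /imsetP[y yN eq_v].
by exists (x, y); rewrite ?eq_u ?eq_v // !inE /= -fe // -eq_u -eq_v.
Qed.

Lemma inj_in_ord (T : finType) (A : {set T}) n :
  0 < n -> #|A| <= n -> exists f : T -> 'I_n, {in A &, injective f}.
Proof.
case: n => // n _ le_n; exists (fun x => inord (index x (enum A))) => x y xA yA.
have index_lt z : z \in A -> index z (enum A) < n.+1.
  by move=> zA; apply: leq_trans le_n; rewrite cardE index_mem mem_enum.
move/(congr1 val); rewrite /= !inordK ?index_lt //.
by apply: (index_inj x); rewrite mem_enum.
Qed.

Lemma bij_in_ord (T : finType) (A : {set T}) n : 0 < n -> #|A| = n ->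
  exists2 f : T -> 'I_n, {in A &, injective f} & f @: A = setT.
Proof.
move=> n_gt0 card_A.
have [|f f_inj] := @inj_in_ord _ A n n_gt0; first by rewrite card_A.
exists f => //; apply/eqP.
by rewrite eqEcard subsetT cardsT card_ord card_in_imset ?card_A /=.
Qed.

Section ImageGraph.
Variables (T U : finType) (e : rel T) (C : {set T}) (f : T -> U).
Hypotheses (sym : symmetric e) (irr : irreflexive e).
Hypothesis f_inj : {in C &, injective f}.

Definition image_graph : rel U :=
  fun u v => [exists x in C, exists y in C, [&& f x == u, f y == v & e x y]].

Lemma image_graphP u v : reflect
  (exists x y, [/\ x \in C, y \in C, u = f x, v = f y & e x y])
  (image_graph u v).
Proof.
apply: (iffP exists_inP) => [[x xC]|[x [y [xC yC -> -> exy]]]].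
  by case/exists_inP=> y yC /and3P[/eqP<- /eqP<- exy]; exists x, y.
by exists x => //; apply/exists_inP; exists y; rewrite ?eqxx.
Qed.

Lemma image_graphE : {in C &, forall x y, image_graph (f x) (f y) = e x y}.
Proof.
move=> x y xC yC; apply/image_graphP/idP => [[x' [y' [xC' yC']]]|exy].
  by move=> /f_inj-> // /f_inj->.
by exists x, y.
Qed.

Lemma image_graph_simple : simple_graph image_graph.
Proof.
split=> [u v|u].
  by apply/image_graphP/image_graphP => -[x [y [xC yC -> -> exy]]];
     exists y, x; rewrite sym.
by apply/image_graphP=> -[x [y [xC yC -> /f_inj-> //]]]; rewrite irr.
Qed.

Lemma deg_image_graph_notin u : u \notin f @: C -> deg image_graph u = 0.
Proof.
move=> uC; apply: eq_card0 => v; rewrite inE.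
apply/image_graphP=> -[x [y [xC _ eq_u _ _]]].
by rewrite eq_u imset_f in uC.
Qed.

Lemma non_isolated_image_graph :
  non_isolated image_graph \subset f @: (C :&: non_isolated e).
Proof.
apply/subsetP=> u; rewrite inE => /existsP[v].
case/image_graphP=> x [y [xC _ -> _ exy]].
by rewrite imset_f // !inE xC; apply/existsP; exists y.
Qed.

Hypothesis closedC : closed e C.

Lemma deg_image_graph : {in C, forall x, deg image_graph (f x) = deg e x}.
Proof.
move=> x xC; rewrite /deg -[RHS](card_in_imset (f := f)); last first.
  move=> y z; rewrite !inE => exy exz.
  by apply: f_inj; rewrite -?(closedC exy) -?(closedC exz).
apply: eq_card => u; rewrite inE; apply/image_graphP/imsetP => [|[y]].
  case=> x' [y [xC' yC /f_inj eq_x -> exy]]; exists y; rewrite // inE.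
  by rewrite eq_x.
by rewrite inE => exy ->; exists x, y; rewrite -(closedC exy).
Qed.

(* A vertex of [U] missed by [f] has degree [0], which is [d.-1] only if
   [d <= 1]. *)
Lemma image_graph_almost_regular d :
  {in C, forall x, deg e x = d \/ deg e x = d.-1} ->
  #|[set x in C | deg e x != d]| + (#|U| - #|C|) <= 1 ->
  (#|C| < #|U| -> d <= 1) ->
  almost_regular image_graph d.
Proof.
move=> deg_C deficient_le1 small_d.
have card_out : #|~: (f @: C)| = #|U| - #|C|.
  by rewrite cardsCs setCK card_in_imset.
split=> [u|].
  have [/imsetP[x xC ->]|uC] := boolP (u \in f @: C).
    by rewrite deg_image_graph //; apply: deg_C.
  rewrite deg_image_graph_notin //; right.
  have : 0 < #|~: (f @: C)| by apply/card_gt0P; exists u; rewrite inE.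
  by rewrite card_out subn_gt0 => /small_d; lia.
apply: leq_trans deficient_le1; rewrite -card_out.
set D := [set x in C | deg e x != d].
apply: leq_trans (_ : #|f @: D :|: ~: (f @: C)| <= _).
  apply/subset_leq_card/subsetP=> u; rewrite !inE => deg_u.
  have [/imsetP[x xC eq_u]|_] := boolP (u \in f @: C); last by rewrite orbT.
  by rewrite eq_u imset_f // inE xC -deg_image_graph // -eq_u.
by rewrite cardsU (leq_trans (leq_subr _ _)) // leq_add2r leq_imset_card.
Qed.

Lemma image_graph_iso :
  non_isolated e \subset C -> iso_upto_isolated e image_graph.
Proof.
move=> subC; have inC := subsetP subC.
apply: (iso_upto_isolated_subset (f := f)) => //.
- by move=> x y /inC xC /inC yC; apply: f_inj.
- by move=> x y /inC xC /inC yC; apply: image_graphE.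
- by have := non_isolated_image_graph; rewrite (setIidPr subC).
Qed.

End ImageGraph.

Lemma image_graph_iso_union_with_clique (T : finType) (e : rel T)
    (C C' : {set T}) n (f : T -> 'I_n) m :
  symmetric e -> {in C &, injective f} -> closed e C ->
  0 < m -> #|C'| = m -> clique_beside e C C' ->
  iso_upto_isolated e (union_with_clique m (image_graph e C f)).
Proof.
move=> sym f_inj closedC m_gt0 card_C' [dis /subsetP sub /cliqueP clique_C'].
have [g g_inj g_im] := bij_in_ord m_gt0 card_C'.
have g_onto j : j \in g @: C' by rewrite g_im.
have notC x : x \in C' -> x \notin C.
  by move=> xC'; rewrite (disjointFl dis xC').
have inC' x : x \in non_isolated e -> x \notin C -> x \in C'.
  by move=> /sub; rewrite inE => /orP[->|].
pose fg x : 'I_n + 'I_m := if x \in C then inl (f x) else inr (g x).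
apply: (iso_upto_isolated_subset (f := fg)) => //; rewrite /fg.
- move=> x y xN yN; case: ifPn => xC; case: ifPn => yC // -[].
    exact: f_inj.
  by apply: g_inj; apply: inC'.
- move=> x y xN yN; case: ifPn => xC; case: ifPn => yC /=.
  + exact: image_graphE.
  + by apply/esym; apply: contraNF yC => /closedC <-.
  + by apply/esym; apply: contraNF xC => /closedC ->.
  + by rewrite clique_C' ?inC' // (inj_in_eq g_inj) ?inC'.
- apply/subsetP=> -[i|i]; rewrite inE => /existsP[[j|j]] //= eij.
    have : i \in non_isolated (image_graph e C f).
      by rewrite inE; apply/existsP; exists j.
    move/(subsetP (non_isolated_image_graph _ _ _)).
    case/imsetP=> x /setIP[xC xN] ->.
    by apply/imsetP; exists x; rewrite ?xC.
  have [/imsetP[x xC' eq_i] /imsetP[y yC' eq_j]] := (g_onto i, g_onto j).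
  apply/imsetP; exists x; rewrite ?(negbTE (notC x xC')) ?eq_i //.
  rewrite inE; apply/existsP; exists y; rewrite clique_C' //.
  by apply: contra_neq eij => eq_xy; rewrite eq_i eq_j eq_xy.
Qed.

Definition iso_almost_regular n d (T : finType) (e : rel T) :=
  exists r : rel 'I_n,
    simple_graph r /\ almost_regular r d /\ iso_upto_isolated e r.

Definition iso_almost_regular_union_clique n d m (T : finType) (e : rel T) :=
  exists r : rel 'I_n, simple_graph r /\ almost_regular r d /\
    iso_upto_isolated e (union_with_clique m r).

Section Realization.
Variables (T : finType) (e : rel T) (d : nat).
Hypothesis simple_e : simple_graph e.
Implicit Types C : {set T}.

Lemma nedges_iso_almost_regular n :
  iso_almost_regular n d e -> nedges e = (n * d)./2.
Proof.
case=> r [simple_r [reg_r /(iso_nedges simple_e simple_r) ->]].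
by rewrite (nedges_almost_regular simple_r reg_r) card_ord.
Qed.

Lemma nedges_iso_almost_regular_union_clique n m :
  iso_almost_regular_union_clique n d m e -> nedges e = (n * d)./2 + 'C(m, 2).
Proof.
case=> r [simple_r [reg_r /iso_nedges ->]] //; last first.
  exact: union_with_clique_simple.
rewrite nedges_union_with_clique // (nedges_almost_regular simple_r reg_r).
by rewrite card_ord.
Qed.

Lemma component_iso_almost_regular n C :
  0 < n -> #|C| = n -> almost_regular_component e d C ->
  non_isolated e \subset C ->
  iso_almost_regular n d e.
Proof.
have [sym irr] := simple_e.
move=> n_gt0 card_C [closedC deg_C deficient_le1] sub.
have [f f_inj _] := bij_in_ord n_gt0 card_C.
exists (image_graph e C f); split; first exact: image_graph_simple.
split; last exact: image_graph_iso.
apply: image_graph_almost_regular; rewrite // card_ord card_C ?ltnn //.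
by rewrite subnn addn0.
Qed.

Lemma component_iso_almost_regular_union_clique n m C C' :
  0 < n -> #|C| = n -> 0 < m -> #|C'| = m ->
  almost_regular_component e d C -> clique_beside e C C' ->
  iso_almost_regular_union_clique n d m e.
Proof.
have [sym irr] := simple_e.
move=> n_gt0 card_C m_gt0 card_C' [closedC deg_C deficient_le1] beside.
have [f f_inj _] := bij_in_ord n_gt0 card_C.
exists (image_graph e C f); split; first exact: image_graph_simple.
split; last exact: image_graph_iso_union_with_clique beside.
apply: image_graph_almost_regular; rewrite // card_ord card_C ?ltnn //.
by rewrite subnn addn0.
Qed.

Lemma iso_almost_regular_deg_le1 :
  d <= 1 -> (forall x, deg e x <= d) -> nedges e = d ->
  iso_almost_regular d.*2.+1 d e.
Proof.
have [sym irr] := simple_e.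
move=> d_le1 max_deg card_e; set C := non_isolated e.
have deg_C : {in C, forall x, deg e x = 1 /\ d = 1}.
  by move=> x; rewrite mem_non_isolated; have := max_deg x; lia.
have card_C : #|C| = d.*2.
  rewrite -card_e -handshake // narcsT (bigID (mem C)) /= addnC big1 ?add0n.
    by rewrite -sum1_card; apply: eq_bigr => x /deg_C[].
  by move=> x; rewrite mem_non_isolated -eqn0Ngt => /eqP.
have [||f f_inj] := @inj_in_ord _ C d.*2.+1; rewrite ?card_C //.
have closedC : closed e C.
  by move=> x y /(edge_non_isolated sym)[xC yC]; rewrite xC yC.
exists (image_graph e C f); split; first exact: image_graph_simple.
split; last exact: image_graph_iso.
apply: image_graph_almost_regular => // [x /deg_C[-> ->]|]; first by left.
rewrite card_C card_ord subSnn (_ : [set _ in _ | _] = set0) ?cards0 //.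
by apply/setP=> x; rewrite in_set0 in_set; apply/andP=> -[/deg_C[-> ->]].
Qed.

End Realization.

Section ForbiddenFamily.
Variables (T : finType) (e : rel T) (d : nat).
Hypothesis simple_e : simple_graph e.
Hypothesis star_free : ~ contains (star_graph d.+1) e.
Hypothesis matching_free : ~ contains (matching_graph d.+1) e.
Hypothesis two_stars_free : ~ contains (two_stars_graph d.+1) e.

Let max_deg x : deg e x <= d.
Proof. by have [sym irr] := simple_e; rewrite -ltnS; apply: star_free_deg. Qed.

Let full_nbhds_meet u v : deg e u = d -> deg e v = d ->
  ~~ [disjoint closed_nbhd e u & closed_nbhd e v].
Proof.
have [sym irr] := simple_e => deg_u deg_v.
by apply: (two_stars_free_meet sym irr two_stars_free); rewrite ?deg_u ?deg_v.
Qed.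

Lemma nedges_le_sqr : nedges e <= d * d + d./2.
Proof.
have [sym irr] := simple_e.
have [S [P [sep weight_le]]] := matching_free_separates sym irr matching_free.
rewrite -leq_double -(handshake sym irr).
exact: (narcs_le_sqr sym irr max_deg full_nbhds_meet sep weight_le).
Qed.

Lemma extremal_iso : nedges e = d * d + d./2 ->
  iso_almost_regular d.*2.+1 d e \/
  odd d /\ iso_almost_regular_union_clique d.+2 d d e.
Proof.
have [sym irr] := simple_e => card_e.
have [d_le1|d_gt1] := leqP d 1.
  by left; apply: iso_almost_regular_deg_le1 => //; nia.
have [S [P [sep weight_le]]] := matching_free_separates sym irr matching_free.
have extremal : narcs e setT = (d * d + d./2).*2 by rewrite handshake // card_e.
have [C reg_C] := extremal_components sym irr max_deg full_nbhds_meet sep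
  weight_le d_gt1 extremal.
case=> [[card_C sub]|[odd_d card_C [C' card_C' beside]]]; [left | right].
  exact: component_iso_almost_regular sub.
split=> //; apply: component_iso_almost_regular_union_clique beside => //.
exact: ltnW.
Qed.

End ForbiddenFamily.

Theorem theorem1p3 (T : finType) (e : rel T) (k : nat) :
  0 < k -> simple_graph e ->
  ~ contains (star_graph k) e ->
  ~ contains (matching_graph k) e ->
  ~ contains (two_stars_graph k) e ->
  nedges e <= g1 k /\
  (nedges e = g1 k <->
     (exists r : rel 'I_(2 * k - 1),
         simple_graph r /\ almost_regular r (k - 1) /\ iso_upto_isolated e r)
     \/
     (~~ odd k /\
      exists r : rel 'I_(k + 1),
         simple_graph r /\ almost_regular r (k - 1) /\
         iso_upto_isolated e (union_with_clique (k - 1) r))).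
Proof.
case: k => // d _ simple_e star_free matching_free two_stars_free.
have -> : 2 * d.+1 - 1 = d.*2.+1 by lia.
rewrite subn1 addn1 g1S /= negbK.
split; first exact: nedges_le_sqr; split; first exact: extremal_iso.
case=> [/(nedges_iso_almost_regular simple_e)->|[odd_d]].
  by lia.
move/(nedges_iso_almost_regular_union_clique simple_e)->; rewrite bin2.
by lia.
Qed.
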